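(* Let $n \ge 3$ and $k$ be positive integers with $k \le \lfloor \frac{n}{2} \rfloor$. Let $S = \{s_1, s_2, \ldots, s_k\}$ be a subset of $[n]$ with $s_1 < s_2 < \cdots < s_k$. Then $S$ is a pinnacle set of the cycle graph $C_n$ on $n$ vertices if and only if $\ell(s_i) \ge i+1$ for all $1 \le i \le k-1$ and $s_k = n$.
   Context: Graphs are finite and simple, and $[n] = \{1,2,\ldots,n\}$. A labeling of a graph $G$ with $n$ vertices is a bijection $\lambda : V(G) \to [n]$. The label $\lambda(u)$ of a vertex $u$ is a pinnacle of $(G,\lambda)$ if $\lambda(u) > \lambda(v)$ for every neighbor $v$ of $u$. The pinnacle set of $(G,\lambda)$ is the set of all pinnacles of $(G,\lambda)$. A subset $S \subseteq [n]$ is a pinnacle set of $G$ if there is a labeling $\lambda$ of $G$ such that $S$ is the pinnacle set of $(G,\lambda)$. For $S = \{s_1,\ldots,s_k\} \subseteq [n]$, define $\ell(s_i) = |\{x \in [n]\setminus S : x < s_i\}|$, the number of elements of $[n]$ that are less than $s_i$ and are not in $S$. *)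

(* Defs.v *)
From mathcomp Require Import all_boot finmap.

Set Implicit Arguments.
Unset Strict Implicit.
Unset Printing Implicit Defensive.

Local Open Scope fset_scope.

Record sgraph := SGraph {
  vertex :> finType;
  adj : rel vertex;
  adj_sym : symmetric adj;
  adj_irr : irreflexive adj
}.

(* The set [n] = {1, ..., n}; labels start at 1. *)
Definition interval (n : nat) : {fset nat} := [fset x in iota 1 n].

(* A bijection from the vertices onto [#|G|], as a nat-valued function. *)
Definition labeling (G : sgraph) (lam : G -> nat) : Prop :=
  injective lam /\ [fset lam v | v in G] = interval #|G|.

Definition is_peak (G : sgraph) (lam : G -> nat) (u : G) : bool :=
  [forall v, adj u v ==> (lam v < lam u)].

Definition pinnacles (G : sgraph) (lam : G -> nat) : {fset nat} :=
  [fset lam u | u in G & is_peak lam u].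

Definition is_pinnacle_set (G : sgraph) (S : {fset nat}) : Prop :=
  exists lam : G -> nat, labeling lam /\ pinnacles lam = S.

Definition ell (n : nat) (S : {fset nat}) (s : nat) : nat :=
  #|` [fset x in interval n `\` S | x < s] |.

(* [ordS] is the successor modulo n. The disequality only matters for n = 1,
   where it removes the loop; for n >= 3 this is the n-cycle. *)
Definition cycle_adj (n : nat) : rel 'I_n :=
  fun i j => (i != j) && ((ordS i == j) || (ordS j == i)).

Lemma cycle_adj_sym (n : nat) : symmetric (@cycle_adj n).
Proof. by move=> i j; rewrite /cycle_adj eq_sym orbC. Qed.

Lemma cycle_adj_irr (n : nat) : irreflexive (@cycle_adj n).
Proof. by move=> i; rewrite /cycle_adj eqxx. Qed.

Definition cycle_graph (n : nat) : sgraph :=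
  SGraph (@cycle_adj_sym n) (@cycle_adj_irr n).

(* Main.v *)
Require Import Defs.
From mathcomp Require Import zify.
From mathcomp Require Import all_boot all_order finmap.

Local Open Scope fset_scope.

(** Necessity.  The vertex labelled [n] beats all its neighbours, so [n] is in
    [S] and must be its largest element.  For [i < k], let [A] be the set of
    the [i] peaks labelled [s 1], ..., [s i] and [N] the set of their
    neighbours.  The vertices of [N] are not peaks and carry labels below
    [s i], so [#|N| <= ell n S (s i)].  The successors of [A] already give
    [#|A|] vertices of [N], and so do the predecessors.  If [N] had no other
    vertex, both shifts of [A] would equal [N], hence [A :|: N] would be
    invariant under rotation and would fill the cycle.  But the peak labelled
    [s k] is neither in [A] nor, being a peak, in [N].  Hence [#|N| > i]
    ([cycle_neighbors_expand], [low_peaks_lt_ell]).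

    Sufficiency.  Let [t 0 < t 1 < ... < t (n - k - 1)] be the labels outside
    [S], and write around the cycle
<<
      t 0, s 1, t 1, s 2, ..., s (k - 1), t (k - 1), t k, ..., t (n - k - 1), s k.
>>
    The hypothesis on [ell] says [t i < s i] for [i < k], so that each [s i]
    exceeds its neighbours [t (i - 1)] and [t i]; and [s k = n] exceeds
    every other label.  Each [t j] is smaller than the label that follows it: the
    next label is [t (j + 1)], or [n], or [s (j + 1)] with
    [t j < t (j + 1) < s (j + 1)].  So the pinnacles are exactly [S]
    ([arrangement_ascent], [arrangement_peak]). *)

(** * Labelings and their pinnacles *)

Lemma mem_interval n x : (x \in interval n) = (0 < x <= n).
Proof. by rewrite in_fset /= mem_iota; lia. Qed.

Lemma card_interval n : #|` interval n| = n.
Proof. by rewrite card_fseq undup_id ?iota_uniq ?size_iota. Qed.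

Lemma labeling_of_injective (G : sgraph) (lam : G -> nat) :
  injective lam -> (forall v, lam v \in interval #|G|) -> labeling lam.
Proof.
move=> inj_lam lam_in; split=> //; apply/eqP; rewrite eqEfcard; apply/andP; split.
  by apply/fsubsetP=> x /imfsetP[v _ ->].
by rewrite card_interval card_imfset //= -cardE.
Qed.

Lemma labeling_onto (G : sgraph) (lam : G -> nat) x :
  labeling lam -> x \in interval #|G| -> exists v, lam v = x.
Proof. by case=> _ <- /imfsetP[v _ ->]; exists v. Qed.

Lemma labeling_mem (G : sgraph) (lam : G -> nat) v :
  labeling lam -> lam v \in interval #|G|.
Proof. by case=> _ <-; apply/imfsetP; exists v. Qed.

Lemma mem_pinnacles (G : sgraph) (lam : G -> nat) u :
  injective lam -> (lam u \in pinnacles lam) = is_peak lam u.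
Proof.
move=> inj_lam; apply/imfsetP/idP=> [[v]|pk_u]; last first.
  by exists u => //; rewrite inE.
by rewrite inE => pk_v /inj_lam ->.
Qed.

(** Since a labeling is onto the label set, every element of [S] is the label
    of some vertex; it suffices to decide which vertices are peaks. *)
Lemma pinnacles_eq (G : sgraph) (lam : G -> nat) (S : {fset nat}) :
  labeling lam -> S `<=` interval #|G| ->
  (forall u, is_peak lam u = (lam u \in S)) -> pinnacles lam = S.
Proof.
move=> lab S_sub pkE; apply/fsetP=> x; apply/idP/idP.
  by case/imfsetP=> u; rewrite inE /= pkE => ? ->.
move=> xS; have [u ux] := labeling_onto _ _ _ lab (fsubsetP S_sub _ xS).
by rewrite -ux (mem_pinnacles _ _ _ lab.1) pkE ux.
Qed.

Lemma top_label_pinnacle (G : sgraph) (lam : G -> nat) :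
  labeling lam -> 0 < #|G| -> #|G| \in pinnacles lam.
Proof.
move=> lab G_gt0; have [|u u_top] := labeling_onto _ _ #|G| lab.
  by rewrite mem_interval G_gt0 leqnn.
rewrite -u_top (mem_pinnacles _ _ _ lab.1).
apply/forallP=> v; apply/implyP=> uv.
have := labeling_mem _ _ v lab; rewrite mem_interval -u_top => /andP[_].
rewrite leq_eqVlt => /orP[/eqP/lab.1 v_u|//].
by rewrite v_u adj_irr in uv.
Qed.

(** * Neighbourhoods in a cycle *)

Lemma ordS_closed_setT n (B : {set 'I_n}) x :
  x \in B -> (forall y, y \in B -> ordS y \in B) -> B = [set: 'I_n].
Proof.
move=> xB B_closed; apply/setP=> y; rewrite inE.
have itB m : iter m (@ordS n) x \in B by elim: m => //= m; exact: B_closed.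
have itE m : iter m (@ordS n) x = (x + m) %% n :> nat.
  elim: m => [|m IHm] /=; first by rewrite addn0 modn_small.
  by rewrite IHm addnS -[(_ %% n).+1]addn1 modnDml addn1.
suff -> : y = iter (y + (n - x)) (@ordS n) x by exact: itB.
apply: val_inj; rewrite /= itE.
have -> : (x + (y + (n - x)) = y + n)%N by have := ltn_ord x; lia.
by rewrite modnDr modn_small.
Qed.

(** Each of the two shifts of [A] has the size of [A].  If their union is no
    larger, both shifts coincide with the union, so that shifting [A] gives the
    union and shifting the union, as a set of predecessors, gives [A] back;
    then [A] and its neighbours fill the cycle. *)
Lemma cycle_neighbors_expand n (A : {set 'I_n}) x :
  A != set0 -> x \notin A :|: (@ordS n @: A :|: @ord_pred n @: A) ->
  #|A| < #|@ordS n @: A :|: @ord_pred n @: A|.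
Proof.
case/set0Pn=> a aA; set N := (@ordS n @: A :|: _) => xN; rewrite ltnNge.
apply: contraNN xN => leN.
have cS : #|@ordS n @: A| = #|A| by apply/card_imset/ordS_inj.
have cP : #|@ord_pred n @: A| = #|A| by apply/card_imset/(can_inj (@ord_predK n)).
have eqS : @ordS n @: A = N.
  by apply/eqP; rewrite eqEcard cS leN andbT; exact: subsetUl.
have eqP : @ord_pred n @: A = N.
  by apply/eqP; rewrite eqEcard cP leN andbT; exact: subsetUr.
rewrite (@ordS_closed_setT n (A :|: N) a) ?inE ?aA // => y.
rewrite !(in_setU _ A) => /orP[yA|]; first by rewrite -eqS imset_f ?orbT.
by rewrite -eqP => /imsetP[z zA ->]; rewrite ord_predK zA.
Qed.

Lemma adj_ordS n (u : 'I_n) : 1 < n -> cycle_adj u (ordS u).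
Proof.
move=> n_gt1; rewrite /cycle_adj eqxx andbT -val_eqE /=.
have u_lt := ltn_ord u; case: (ltngtP u.+1 n) => [lt|gt|eq].
- by rewrite modn_small; lia.
- lia.
- by rewrite eq modnn; lia.
Qed.

Lemma adj_ord_pred n (u : 'I_n) : 1 < n -> cycle_adj u (ord_pred u).
Proof.
by move=> n_gt1; rewrite cycle_adj_sym -{2}(ord_predK u); exact: adj_ordS.
Qed.

(** A neighbour of a peak in [A] has a label below [x] and is not a peak, so
    neighbours of [A] are counted by [ell].  The higher peak [w] lies outside
    [A] and its neighbours, which makes the count strict. *)
Lemma low_peaks_lt_ell n (lam : cycle_graph n -> nat) (x : nat)
    (A := [set u : 'I_n | is_peak lam u & lam u <= x]) (w : 'I_n) :
  1 < n -> labeling lam -> A != set0 -> is_peak lam w -> x < lam w ->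
  #|A| < ell n (pinnacles lam) x.
Proof.
move=> n_gt1 lab A_n0 pk_w xw; pose N := @ordS n @: A :|: @ord_pred n @: A.
have N_adj v : v \in N -> exists2 u, u \in A & cycle_adj u v.
  by case/setUP=> /imsetP[u uA ->]; exists u; rewrite ?adj_ordS ?adj_ord_pred.
have N_lt v : v \in N -> ~~ is_peak lam v /\ lam v < x.
  case/N_adj=> u; rewrite inE => /andP[pk_u ux] uv.
  have vu : lam v < lam u by have /forallP/(_ v)/implyP := pk_u; apply.
  split; last exact: leq_trans vu ux.
  apply/negP=> /forallP/(_ u)/implyP; rewrite /= cycle_adj_sym => /(_ uv).
  by rewrite ltnNge (ltnW vu).
apply: (@leq_trans #|N|).
  apply: (@cycle_neighbors_expand n A w) => //.
  rewrite in_setU -/N inE pk_w /= leqNgt xw /=.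
  by apply/negP=> /N_lt[]; rewrite pk_w.
rewrite cardE -(size_map lam) /ell.
apply: uniq_leq_size; first by rewrite (map_inj_uniq lab.1) enum_uniq.
move=> y /mapP[v]; rewrite mem_enum => /N_lt[npk_v vx] ->.
apply/imfsetP; exists (lam v) => //=.
rewrite inE in_fsetD (mem_pinnacles _ _ _ lab.1) npk_v vx andbT.
by have := labeling_mem _ _ v lab; rewrite card_ord.
Qed.

(** * A labeling with prescribed pinnacles *)

Section Arrangement.

Variables (n k : nat) (s : nat -> nat) (S : {fset nat}).
Hypothesis n_ge3 : 3 <= n.
Hypothesis k_gt0 : 0 < k.
Hypothesis k_le : k <= n %/ 2.
Hypothesis s_incr : forall i j, 1 <= i -> i < j -> j <= k -> s i < s j.
Hypothesis S_def : S = [fset s i | i in iota 1 k].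
Hypothesis S_sub : S `<=` interval n.

Definition nonpinnacles := [seq x <- iota 1 n | x \notin S].
Notation t := (nth 0 nonpinnacles).

Lemma s_injective i j : 0 < i <= k -> 0 < j <= k -> s i = s j -> i = j.
Proof.
move=> /andP[i0 ik] /andP[j0 jk] sij.
case: (ltngtP i j) => // lt.
  by have := s_incr _ _ i0 lt jk; rewrite sij ltnn.
by have := s_incr _ _ j0 lt ik; rewrite sij ltnn.
Qed.

Lemma s_mem_S i : 0 < i <= k -> s i \in S.
Proof. by rewrite S_def => ik; rewrite in_imfset //= mem_iota add1n ltnS. Qed.

Lemma uniq_nonpinnacles : uniq nonpinnacles.
Proof. exact/filter_uniq/iota_uniq. Qed.

Lemma size_nonpinnacles : size nonpinnacles = n - k.
Proof.
have cS : #|` S| = k.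
  rewrite S_def card_in_imfset /= ?undup_id ?iota_uniq ?size_iota // => i j.
  by rewrite !mem_iota => *; apply: s_injective => //; lia.
have -> : size nonpinnacles = #|` interval n `\` S|.
  rewrite -(undup_id uniq_nonpinnacles) -card_fseq.
  congr #|` _|; apply/fsetP=> x.
  by rewrite in_fsetD mem_interval in_fset /= mem_filter mem_iota; congr andb; lia.
by rewrite cardfsDS // card_interval cS.
Qed.

Lemma sorted_nonpinnacles : sorted ltn nonpinnacles.
Proof. by apply: sorted_filter (iota_ltn_sorted 1 n); exact: ltn_trans. Qed.

Lemma nonpinnacle_incr i j : i < j -> j < n - k -> t i < t j.
Proof.
move=> ij jm; apply: (sorted_ltn_nth ltn_trans 0 sorted_nonpinnacles) => //;
  rewrite inE size_nonpinnacles; lia.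
Qed.

Lemma nonpinnacle_inj i j : i < n - k -> j < n - k -> t i = t j -> i = j.
Proof.
move=> im jm tij; case: (ltngtP i j) => // lt.
- by have := nonpinnacle_incr _ _ lt jm; rewrite tij ltnn.
- by have := nonpinnacle_incr _ _ lt im; rewrite tij ltnn.
Qed.

Lemma nonpinnacle_mem i : i < n - k -> (t i \notin S) && (0 < t i <= n).
Proof.
rewrite -size_nonpinnacles => /(mem_nth 0).
by rewrite mem_filter mem_iota add1n ltnS.
Qed.

(** [ell n S x] counts the entries of the increasing sequence [t] below [x];
    these form an initial segment. *)
Lemma nonpinnacle_lt i x : i < ell n S x -> t i < x.
Proof.
have -> : ell n S x = count (fun y => y < x) nonpinnacles.
  rewrite /ell -size_filter -(undup_id (filter_uniq _ uniq_nonpinnacles)).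
  rewrite -card_fseq; congr #|` _|; apply/fsetP=> y.
  rewrite [RHS]in_fset /= !mem_filter mem_iota.
  rewrite add1n ltnS; apply/imfsetP/idP=> [[z]|y_in].
    by rewrite inE /= in_fsetD mem_interval andbC => z_in ->.
  by exists y; rewrite // inE /= in_fsetD mem_interval andbC.
move=> ix.
have le_t : sorted (@Order.le _ nat) nonpinnacles.
  by apply: sub_sorted sorted_nonpinnacles => a b /ltnW.
exact: (@Order.POrderTheory.nth_count_lt _ nat x 0 _ i le_t ix).
Qed.

(** The first [k - 1] pinnacles occupy the odd positions 1, 3, ..., 2k - 3, and
    the last one occupies the last position. *)
Definition peak_position p := (p == n.-1) || odd p && (p < k.-1.*2).

(** At a position [p] that is not a peak, [minn p./2 k.-1] is the number of
    pinnacles placed before [p], hence the index of the non-pinnacle. *)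
Definition arrangement p :=
  if p == n.-1 then s k
  else if odd p && (p < k.-1.*2) then s p./2.+1
  else t (p - minn p./2 k.-1).

Lemma nonpeak_index_lt p :
  p < n -> ~~ peak_position p -> p - minn p./2 k.-1 < n - k.
Proof. by rewrite /peak_position; lia. Qed.

Lemma nonpeak_index_inj p q :
  ~~ peak_position p -> ~~ peak_position q ->
  p - minn p./2 k.-1 = q - minn q./2 k.-1 -> p = q.
Proof.
(* The position can be read off the index of the non-pinnacle. *)
have posE r : ~~ peak_position r -> forall i, i = r - minn r./2 k.-1 ->
    r = if i < k.-1 then i.*2 else (i + k.-1)%N.
  rewrite /peak_position negb_or => /andP[_ npk] i ->.
  case: (leqP k.-1 r./2) npk => [le|lt] npk; first by case: ifP; lia.
  by case: ifP; lia.
move=> npk_p npk_q eq_pq.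
exact: etrans (posE p npk_p _ (esym eq_pq)) (esym (posE q npk_q _ erefl)).
Qed.

Lemma arrangement_nonpeak p :
  ~~ peak_position p -> arrangement p = t (p - minn p./2 k.-1).
Proof. by rewrite /arrangement /peak_position negb_or => /andP[/negPf-> /negPf->]. Qed.

Lemma arrangement_memS p : p < n -> (arrangement p \in S) = peak_position p.
Proof.
move=> pn; case: (boolP (peak_position p)) => pk; last first.
  rewrite arrangement_nonpeak //; apply/negbTE.
  by have /andP[] := nonpinnacle_mem _ (nonpeak_index_lt _ pn pk).
rewrite /arrangement; case: ifP => p_last; first by apply: s_mem_S; lia.
move: pk; rewrite /peak_position p_last /= => pk; rewrite pk.
by apply: s_mem_S; lia.
Qed.

Lemma arrangement_mem p : p < n -> arrangement p \in interval n.
Proof.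
move=> pn; have := arrangement_memS p pn.
case: (boolP (peak_position p)) => pk; first exact: (fsubsetP S_sub).
rewrite arrangement_nonpeak // mem_interval => _.
by have /andP[] := nonpinnacle_mem _ (nonpeak_index_lt _ pn pk).
Qed.

Lemma peak_arrangement_inj p q :
  peak_position p -> peak_position q -> arrangement p = arrangement q -> p = q.
Proof.
rewrite /arrangement /peak_position.
case: (eqVneq p n.-1) => [->|_] /=; case: (eqVneq q n.-1) => [->|_] //=.
- move=> _ q_odd; rewrite q_odd => /s_injective eq_s.
  by have : k = q./2.+1 by [apply: eq_s; lia]; lia.
- move=> p_odd _; rewrite p_odd => /s_injective eq_s.
  by have : p./2.+1 = k by [apply: eq_s; lia]; lia.
move=> p_odd q_odd; rewrite p_odd q_odd => /s_injective eq_s.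
by have : p./2.+1 = q./2.+1 by [apply: eq_s; lia]; lia.
Qed.

Lemma arrangement_inj p q : p < n -> q < n -> arrangement p = arrangement q -> p = q.
Proof.
move=> pn qn eq_pq.
have pkE : peak_position p = peak_position q by rewrite -!arrangement_memS // eq_pq.
case: (boolP (peak_position p)) => pk_p; have pk_q := pk_p; rewrite pkE in pk_q.
  exact: peak_arrangement_inj.
apply: nonpeak_index_inj => //; apply: nonpinnacle_inj; try exact: nonpeak_index_lt.
by rewrite -!arrangement_nonpeak.
Qed.

Hypothesis ell_ge : forall i, 1 <= i -> i <= k - 1 -> i + 1 <= ell n S (s i).
Hypothesis s_top : s k = n.

(** The case [j = i] is the hypothesis on [ell], shifted because [t] is indexed
    from 0. *)
Lemma nonpinnacle_lt_pinnacle i j : 0 < i < k -> j <= i -> t j < s i.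
Proof.
move=> i_k ji; apply: nonpinnacle_lt; have := ell_ge i; lia.
Qed.

(** Every position outside the peaks is followed by a larger label; this alone
    keeps it from being a peak. *)
Lemma arrangement_ascent p :
  p < n -> ~~ peak_position p -> arrangement p < arrangement p.+1.
Proof.
move=> pn npk; rewrite arrangement_nonpeak //.
have /andP[tS /andP[_ t_le]] := nonpinnacle_mem _ (nonpeak_index_lt _ pn npk).
move: npk; rewrite /peak_position => npk.
rewrite /arrangement; case: ifP => [_|p1_last].
  rewrite s_top ltn_neqAle t_le andbT; apply: contraNneq tS => ->.
  by rewrite -s_top s_mem_S //; lia.
case: ifP => p1_odd; first by apply: nonpinnacle_lt_pinnacle; lia.
by apply: nonpinnacle_incr; lia.
Qed.

(** The top label dominates everything; any other peak is at an odd position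
    [2i - 1] away from both ends of the cycle, between [t (i - 1)] and [t i]. *)
Lemma arrangement_peak p q : p < n -> q < n -> p <> q -> peak_position p ->
  q = p.+1 %% n \/ p = q.+1 %% n -> arrangement q < arrangement p.
Proof.
move=> pn qn pq pk_p adj_pq.
case: (boolP (p == n.-1)) => [p_last|p_nlast].
  have p_n : arrangement p = n by rewrite /arrangement p_last.
  have := arrangement_mem q qn; rewrite mem_interval p_n => /andP[_ q_le].
  rewrite ltn_neqAle q_le andbT; apply/eqP=> q_n; case: pq.
  by apply: arrangement_inj; rewrite ?p_n.
have p_odd : odd p && (p < k.-1.*2).
  by move: pk_p; rewrite /peak_position (negPf p_nlast).
have q_near : q = p.+1 \/ q = p.-1.
  case: adj_pq => [->|]; first by left; rewrite modn_small; lia.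
  case: (ltngtP q.+1 n) => [lt|gt|->]; last by rewrite modnn; lia.
    by rewrite modn_small; lia.
  lia.
clear adj_pq pk_p.
have [j p_j] : exists j, p = j.*2.+1 by exists p./2; lia.
have q_j : q = j.*2 \/ q = j.+1.*2 by lia.
have jk : j.+1 < k by lia.
have npk_q : ~~ peak_position q.
  by rewrite /peak_position; case: q_j => ->; rewrite odd_double /=; lia.
rewrite arrangement_nonpeak // /arrangement (negPf p_nlast) p_odd.
have -> : p./2 = j by lia.
by apply: nonpinnacle_lt_pinnacle => //; case: q_j => ->; rewrite doubleK; lia.
Qed.

Lemma arrangement_realizes : is_pinnacle_set (cycle_graph n) S.
Proof.
have lab : @labeling (cycle_graph n) (fun u : 'I_n => arrangement u).
  apply: labeling_of_injective => [u v /arrangement_inj eq_uv|u].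
    exact/val_inj/eq_uv.
  by rewrite card_ord; exact: arrangement_mem.
exists (fun u : 'I_n => arrangement u); split=> //.
apply: pinnacles_eq => //; first by rewrite card_ord.
move=> /= u; rewrite arrangement_memS //.
case: (boolP (peak_position u)) => pk_u.
  apply/forallP=> v; apply/implyP=> /andP[uv adj_uv].
  apply: arrangement_peak => //; first by move=> u_v; case/eqP: uv; exact: val_inj.
  by case/orP: adj_uv => /eqP<-; [left|right].
have u1_lt : u.+1 < n by move: pk_u; rewrite /peak_position; have := ltn_ord u; lia.
apply/negbTE/negP=> /forallP/(_ (ordS u))/implyP/(_ (adj_ordS _ _ _)).
rewrite /= modn_small // => /(_ ltac:(lia)).
by rewrite ltnNge ltnW // arrangement_ascent.
Qed.

End Arrangement.

Theorem theorem3p6 (n k : nat) (s : nat -> nat) (S : {fset nat})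
    (n_ge3 : 3 <= n) (k_gt0 : 0 < k) (k_le : k <= n %/ 2)
    (s_incr : forall i j, 1 <= i -> i < j -> j <= k -> s i < s j)
    (S_def : S = [fset s i | i in iota 1 k])
    (S_sub : S `<=` interval n) :
  is_pinnacle_set (cycle_graph n) S <->
  (forall i, 1 <= i -> i <= k - 1 -> i + 1 <= ell n S (s i)) /\ s k = n.
Proof.
have sS i : 0 < i <= k -> s i \in S by apply: s_mem_S.
split; last by case=> ell_ge s_top; apply: arrangement_realizes ell_ge s_top.
case=> lam [lab pinE].
have peak_of i : 0 < i <= k -> exists2 u : 'I_n, lam u = s i & is_peak lam u.
  move=> /sS; rewrite -{1}pinE => /imfsetP[u]; rewrite inE /= => pk_u s_u.
  by exists u.
split=> [i i_gt0 i_lt|]; last first.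
  have := top_label_pinnacle _ _ lab; rewrite pinE card_ord => nS.
  have : n \in S by apply: nS; lia.
  rewrite S_def => /imfsetP[j]; rewrite /= mem_iota => j_k n_sj.
  have := fsubsetP S_sub _ (sS k ltac:(lia)); rewrite mem_interval.
  have := s_incr j k; rewrite n_sj.
  case: (ltngtP j k) => [jk|jk|->] //; last lia.
  lia.
(* Since [i < k], the peak [w] labelled [s k] is higher than those counted. *)
have [w w_k pk_w] := peak_of k ltac:(lia).
pose A := [set u : 'I_n | is_peak lam u & lam u <= s i].
have iA : i <= #|A|.
  rewrite cardE -(size_map lam) -[i in i <= _](size_iota 1) -(size_map s).
  apply: uniq_leq_size => [|x /mapP[j]].
    rewrite map_inj_in_uniq ?iota_uniq // => a b; rewrite !mem_iota => a_i b_i.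
    by apply: (@s_injective k s); [exact: s_incr|lia|lia].
  rewrite mem_iota => j_i ->; have [u u_j pk_u] := peak_of j ltac:(lia).
  rewrite -u_j map_f // mem_enum inE pk_u u_j.
  by case: (ltngtP j i) => [ji|ji|->]; [rewrite ltnW ?s_incr|lia|]; lia.
rewrite addn1 -pinE; apply: (leq_ltn_trans iA).
apply: (@low_peaks_lt_ell n lam (s i) w) => //; first by lia.
  by rewrite -card_gt0; apply: leq_trans iA.
by rewrite w_k s_incr //; lia.
Qed.
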